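(* Let $\mu=0$. The inverted equilibrium $(\Gamma_i,0)=\left(-\frac{\rho}{\|\rho\|},0\right)\in TS^2$ of the Routh reduced dynamics of the 3D pendulum described by $$\ddot\Gamma=-\|\dot\Gamma\|^2\Gamma+\Gamma\times\Sigma$$ on $TS^2$ is unstable.
   Context: $J$ is the symmetric positive definite inertia matrix of the rigid body (body frame, origin at the pivot), $m,g>0$, $\rho\in\mathbb{R}^3$, $\rho\neq0$, is the body-fixed vector from the pivot to the center of mass, $\Gamma\in S^2$ is the gravity direction in the body frame, $\mu\in\mathbb{R}$ is the value of the momentum map (vertical component of angular momentum), and $$\Sigma=b\dot\Gamma+J^{-1}\Big[\big(J(\dot\Gamma\times\Gamma)-bJ\Gamma\big)\times\big((\dot\Gamma\times\Gamma)-b\Gamma\big)+\nu^2J\Gamma\times\Gamma-mg\,\Gamma\times\rho-c\,\dot\Gamma\Big],$$ $$c=\nu\Big\{\mathrm{tr}[J]-2\tfrac{\|J\Gamma\|^2}{\Gamma\cdot J\Gamma}\Big\},\quad b=\frac{J\Gamma\cdot(\dot\Gamma\times\Gamma)}{\Gamma\cdot J\Gamma},\quad \nu=\frac{\mu}{\Gamma\cdot J\Gamma}.$$ Unstable means not stable in the sense of Lyapunov. *)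

(* Defs.v *)
From HB Require Import structures.
From mathcomp Require Import all_boot all_order all_algebra.
From mathcomp Require Import all_classical all_reals all_analysis.
Set Implicit Arguments.
Unset Strict Implicit.
Unset Printing Implicit Defensive.
Import Order.TTheory GRing.Theory Num.Theory.
Import numFieldNormedType.Exports.
Local Open Scope classical_set_scope.
Local Open Scope ring_scope.

Section Vectors3.
Context {R : realType}.
Implicit Types (u v : 'cV[R]_3) (A : 'M[R]_3).

Definition dot u v : R := \sum_i u i 0 * v i 0.

(* The library norm `|u| on matrices is the sup norm. *)
Definition enorm u : R := Num.sqrt (dot u u).

(* Indices are added in 'I_3, i.e. modulo 3. *)
Definition cross u v : 'cV[R]_3 :=
  \col_(i < 3) (u (i + 1) 0 * v (i + 2) 0 - u (i + 2) 0 * v (i + 1) 0).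

Definition sym_posdef A : Prop :=
  A^T = A /\ forall u, u != 0 -> 0 < dot u (A *m u).

End Vectors3.

Notation "u '*x' v" := (cross u v)
  (at level 40, left associativity) : ring_scope.

Section Dynamics.
Context {R : realType} {U : normedModType R}.
Implicit Types (M : set U) (f : U -> U).

(* Solutions of x' = f x on [0, T[ that lie in the state space M: continuous
   on [0, T[ (from the right at 0) and differentiable on ]0, T[. *)
Definition is_solution M f (T : R) (x : R -> U) : Prop :=
  [/\ {within `[0, T[, continuous x},
      forall t, 0 <= t < T -> M (x t)
    & forall t, 0 < t < T -> is_derive t 1 x (f (x t))].

Definition is_equilibrium M f (xe : U) : Prop := M xe /\ f xe = 0.

(* Every solution is constrained on its whole interval of existence; T is
   arbitrary, so global solutions are covered.  Consequently, refuting
   stability requires an actual solution that leaves the e-ball. *)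
Definition lyapunov_stable M f (xe : U) : Prop :=
  forall e : R, 0 < e -> exists2 d : R, 0 < d &
    forall (T : R) (x : R -> U), is_solution M f T x ->
      `|x 0 - xe| < d -> forall t, 0 <= t < T -> `|x t - xe| < e.

End Dynamics.

Section Pendulum.
Context {R : realType}.
Implicit Types (J : 'M[R]_3) (m g mu : R) (rho G V : 'cV[R]_3).

(* V stands for the velocity of G. *)

Definition pend_nu J mu G : R := mu / dot G (J *m G).

Definition pend_b J G V : R := dot (J *m G) (V *x G) / dot G (J *m G).

Definition pend_c J mu G : R :=
  pend_nu J mu G * (\tr J - 2 * (enorm (J *m G) ^+ 2 / dot G (J *m G))).

Definition pend_Sigma J m g rho mu G V : 'cV[R]_3 :=
  let b := pend_b J G V in
  let nu := pend_nu J mu G in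
  b *: V + invmx J *m
    ((J *m (V *x G) - b *: (J *m G)) *x ((V *x G) - b *: G)
     + nu ^+ 2 *: ((J *m G) *x G)
     - (m * g) *: (G *x rho)
     - pend_c J mu G *: V).

Definition TS2 : set ('cV[R]_3 * 'cV[R]_3) :=
  [set x | enorm x.1 = 1 /\ dot x.1 x.2 = 0].

(* The second-order equation as a first-order system in x = (G, V). *)
Definition routh_field J m g rho mu (x : 'cV[R]_3 * 'cV[R]_3) :
    'cV[R]_3 * 'cV[R]_3 :=
  (x.2, - (enorm x.2 ^+ 2) *: x.1
        + x.1 *x pend_Sigma J m g rho mu x.1 x.2).

Definition inverted_equilibrium rho : 'cV[R]_3 * 'cV[R]_3 :=
  (- ((enorm rho)^-1 *: rho), 0).

End Pendulum.

(* Main.v *)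
(* In terms of the gravity direction [Gamma] and the body angular velocity [w]
   with [V = Gamma *x w], the dynamics at [mu = 0] is the quadratic system
     [Gamma' = Gamma *x w],  [J w' = J w *x w - m g Gamma *x rho],
   restricted to the invariant set [|Gamma| = 1], [Gamma . J w = 0].  At the
   inverted position its linearization has the eigenvalues [+- lam] where
   [lam^2] runs through the eigenvalues of the pencil [k P - x J], with
   [r = rho / |rho|], [k = m g |rho|] and [P u = - r *x (r *x u)] positive
   semidefinite and nonzero; take the largest [lam > 0].  The ansatz
   [X(s) = sum_n a_n s^n], [s = exp (lam t)], gives a recurrence for [a_n] whose
   left-hand side [n lam - L] is invertible for [n >= 2] because [n lam] is beyond
   the spectrum, with inverse [O(1/n)].  After rescaling the eigenvector [a_1] the
   coefficients are bounded, so the series is an orbit of the unstable manifold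
   that tends to the equilibrium as [t -> -oo] without being constant.  The two
   invariants hold along it since they are conserved and hold at [s = 0]. *)
Require Import Defs.
From HB Require Import structures.
From mathcomp Require Import all_boot all_order all_algebra.
From mathcomp Require Import all_classical all_reals all_analysis.
From mathcomp Require Import ring lra.
Import Order.TTheory GRing.Theory Num.Theory.
Import numFieldNormedType.Exports.
Local Open Scope classical_set_scope.
Local Open Scope ring_scope.

(** * Power series on the unit disk *)

Section PowerSeries.
Context {R : realType}.
Implicit Types (a b : R^nat) (s : R).

Definition disk_cvg a := forall s, `|s| < 1 -> cvgn (pseries a s).

Definition psum a s := limn (pseries a s).

Lemma psum_cvg a s : disk_cvg a -> `|s| < 1 -> pseries a s @ \oo --> psum a s.
Proof. by move=> ca s1; exact: ca. Qed.

Lemma psum_lim a s (l : R) : pseries a s @ \oo --> l -> psum a s = l.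
Proof. by move=> al; exact: cvg_lim. Qed.

Lemma bounded_disk_cvg a (M : R) : (forall n, `|a n| <= M) -> disk_cvg a.
Proof.
move=> aM s s1; apply: normed_cvg.
apply: (@series_le_cvg _ _ (geometric M `|s|)).
- by move=> n /=; exact: normr_ge0.
- by move=> n /=; rewrite mulr_ge0 ?exprn_ge0// (le_trans _ (aM 0%N)).
- by move=> n /=; rewrite normrM normrX ler_wpM2r ?exprn_ge0.
- by apply: is_cvg_geometric_series; rewrite normr_id.
Qed.

Lemma le_disk_cvg a b : (forall n, `|a n| <= b n) -> disk_cvg b -> disk_cvg a.
Proof.
move=> ab cb s s1; apply: normed_cvg.
have s1' : `| `|s| | < 1 by rewrite normr_id.
apply: (@series_le_cvg _ _ (fun n => b n * `|s| ^+ n)) (cb _ s1').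
- by move=> n /=; exact: normr_ge0.
- by move=> n /=; rewrite mulr_ge0 ?exprn_ge0// (le_trans _ (ab n)).
- by move=> n /=; rewrite normrM normrX ler_wpM2r ?exprn_ge0.
Qed.

(** The sum [1 + x + ... + x ^ n] has [n + 1] terms, each at least [x ^ n], and its product with
    [1 - x] is [1 - x ^ n.+1]; hence the bound [(1 - x)^-1]. *)
Lemma natmul_geometric_bounded (x : R) : 0 <= x < 1 ->
  exists M : R, forall n, n.+1%:R * x ^+ n <= M.
Proof.
move=> /andP[x0 x1]; exists (1 - x)^-1 => n.
have dx : 0 < 1 - x by rewrite subr_gt0.
rewrite -[leRHS]mul1r ler_pdivlMr//.
suff : n.+1%:R * x ^+ n * (1 - x) <= 1 - x ^+ n.+1.
  by move=> /le_trans; apply; rewrite gerBl exprn_ge0.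
elim: n => [|n IH]; first by rewrite expr0 expr1 !mul1r.
have xn0 : 0 <= x ^+ n.+1 by rewrite exprn_ge0.
have xn1 : x ^+ n.+1 <= 1 by rewrite exprn_ile1// ltW.
move: (ler_wpM2l x0 IH); rewrite exprS in xn0 xn1 *.
rewrite !exprS -[n.+2]addn1 natrD.
set u := x ^+ n in xn0 xn1 *; set k := n.+1%:R.
nra.
Qed.

(** For [|s| < r < 1] the factor [n + 1] is absorbed by the bounded sequence
    [(n + 1) (|s| / r) ^ n], which leaves the series of [|a n| r ^ n] as a majorant. *)
Lemma disk_cvg_diffs a : disk_cvg a -> disk_cvg (pseries_diffs a).
Proof.
move=> ca s s1.
have [r /andP[sr r1]] : exists r, `|s| < r < 1.
  by exists ((`|s| + 1) / 2); rewrite !midf_lt.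
have r0 : 0 < r by exact: le_lt_trans sr.
have [|M hM] := @natmul_geometric_bounded (`|s| / r).
  by rewrite divr_ge0 ?(ltW r0)//= ltr_pdivrMr// mul1r.
apply: normed_cvg.
apply: (@series_le_cvg _ _ (fun n => (M / r) * (`|a n.+1| * r ^+ n.+1))).
- by move=> n /=; exact: normr_ge0.
- move=> n /=; rewrite mulr_ge0 ?divr_ge0 ?mulr_ge0 ?exprn_ge0 ?(ltW r0)//.
  by apply: le_trans (hM 0%N); rewrite expr0 mulr1.
- move=> n /=; rewrite /pseries_diffs !normrM normrX [X in X * _ * _]ger0_norm//.
  have -> : M / r * (`|a n.+1| * r ^+ n.+1) = M * (`|a n.+1| * r ^+ n).
    by rewrite exprS; field; rewrite gt_eqF.
  have -> : n.+1%:R * `|a n.+1| * `|s| ^+ n =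
      n.+1%:R * (`|s| / r) ^+ n * (`|a n.+1| * r ^+ n).
    rewrite expr_div_n; field.
    by rewrite expf_neq0// gt_eqF.
  by rewrite ler_wpM2r// mulr_ge0// exprn_ge0// ltW.
- apply: is_cvg_seriesZ.
  (* Absolute convergence at [r] follows from convergence at a point [t] beyond it. *)
  have [t /andP[rt t1]] : exists t, r < t < 1.
    by exists ((r + 1) / 2); rewrite !midf_lt.
  have t0 : 0 < t by exact: lt_trans rt.
  have cn : cvgn (pseries (fun i => `|a i|) r).
    apply: (@is_cvg_pseries_inside_norm _ _ t).
      by apply: ca; rewrite gtr0_norm.
    by rewrite !gtr0_norm.
  have -> : series (fun n => `|a n.+1| * r ^+ n.+1) =
      (fun n => pseries (fun i => `|a i|) r n.+1 - `|a 0%N|).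
    apply/funext => n; rewrite /pseries /series/= big_nat_recl//.
    by rewrite expr0 mulr1 addrC addKr.
  apply: is_cvgB; last exact: is_cvg_cst.
  apply/cvg_ex; exists (limn (pseries (fun i => `|a i|) r)).
  by rewrite (cvg_shiftS (pseries (fun i => `|a i|) r)).
Qed.

(** Termwise differentiation rests on convergence of the series and of its first two derived series
    at one point beyond [|s|]; the midpoint of [|s|] and 1 is taken. *)
Lemma psum_is_derive a s : disk_cvg a -> `|s| < 1 ->
  is_derive s 1 (psum a) (psum (pseries_diffs a) s).
Proof.
move=> ca s1.
have rE : `|(`|s| + 1) / 2| = (`|s| + 1) / 2 by rewrite ger0_norm// divr_ge0// addr_ge0.
have cr : `|(`|s| + 1) / 2| < 1 by rewrite rE midf_lt.
apply: (@pseries_snd_diffs _ _ ((`|s| + 1) / 2)).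
- exact: ca.
- exact: disk_cvg_diffs.
- by do 2 apply: disk_cvg_diffs => //.
- by rewrite rE midf_lt.
Qed.

Lemma pseriesD a b s : pseries (fun n => a n + b n) s = pseries a s \+ pseries b s.
Proof.
apply/funext => n; rewrite /pseries /series/= -big_split/=.
by apply: eq_bigr => i _; rewrite mulrDl.
Qed.

Lemma disk_cvgD a b : disk_cvg a -> disk_cvg b -> disk_cvg (fun n => a n + b n).
Proof. by move=> ca cb s s1; rewrite pseriesD; apply: is_cvgD; [exact: ca|exact: cb]. Qed.

Lemma psumD a b s : disk_cvg a -> disk_cvg b -> `|s| < 1 ->
  psum (fun n => a n + b n) s = psum a s + psum b s.
Proof.
by move=> ca cb s1; apply: psum_lim; rewrite pseriesD; apply: cvgD; exact: psum_cvg.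
Qed.

Lemma pseriesZ k a s : pseries (fun n => k * a n) s = k \*: pseries a s.
Proof.
apply/funext => n; rewrite /pseries /series/= scaler_sumr.
by apply: eq_bigr => i _; rewrite -mulrA.
Qed.

Lemma disk_cvgZ k a : disk_cvg a -> disk_cvg (fun n => k * a n).
Proof. by move=> ca s s1; rewrite pseriesZ; apply: is_cvgZr; exact: ca. Qed.

Lemma psumZ k a s : disk_cvg a -> `|s| < 1 ->
  psum (fun n => k * a n) s = k * psum a s.
Proof.
by move=> ca s1; apply: psum_lim; rewrite pseriesZ; apply: cvgZr; exact: psum_cvg.
Qed.

Lemma norm_conv_le a b (M : R) n :
  (forall n, `|a n| <= M) -> (forall n, `|b n| <= M) ->
  `|\sum_(k < n.+1) a k * b (n - k)%N| <= n.+1%:R * M ^+ 2.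
Proof.
move=> aM bM; apply: le_trans (ler_norm_sum _ _ _) _.
apply: (@le_trans _ _ (\sum_(k < n.+1) M ^+ 2)).
  by apply: ler_sum => i _; rewrite normrM expr2 ler_pM.
by rewrite sumr_const card_ord mulr_natl.
Qed.

(** These are the coefficients of the derivative of the series with constant coefficient [M]. *)
Lemma disk_cvg_natmul (M : R) : disk_cvg (fun n => n.+1%:R * M).
Proof.
by apply: (@disk_cvg_diffs (fun=> M)); apply: (@bounded_disk_cvg _ `|M|).
Qed.

Lemma disk_cvgM a b (M : R) : (forall n, `|a n| <= M) -> (forall n, `|b n| <= M) ->
  disk_cvg (fun n => \sum_(k < n.+1) a k * b (n - k)%N).
Proof.
move=> aM bM; apply: le_disk_cvg (disk_cvg_natmul (M ^+ 2)).
by move=> n; exact: norm_conv_le.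
Qed.

(* Truncating both factors at degree [N], the product of the partial sums and
   the [N]-th partial sum of the Cauchy product differ by coefficients of degree
   between [N] and [2 N], which form a tail of a convergent series. *)
Lemma psumM a b (M : R) s :
  (forall n, `|a n| <= M) -> (forall n, `|b n| <= M) -> `|s| < 1 ->
  psum (fun n => \sum_(k < n.+1) a k * b (n - k)%N) s = psum a s * psum b s.
Proof.
move=> aM bM s1.
pose c n := \sum_(k < n.+1) a k * b (n - k)%N.
have ca := bounded_disk_cvg _ _ aM; have cb := bounded_disk_cvg _ _ bM.
have M0 : 0 <= M by rewrite (le_trans _ (aM 0%N)).
pose d n : R := n.+1%:R * M ^+ 2.
have s1' : `| `|s| | < 1 by rewrite normr_id.
have cd : cvgn (pseries d `|s|) by exact: disk_cvg_natmul.
pose A N := \poly_(i < N) a i; pose B N := \poly_(i < N) b i.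
have hA (u : R^nat) N : (\poly_(i < N) u i).[s] = pseries u s N.
  by rewrite horner_poly /pseries /series/= big_mkord.
have small N n : `|(A N * B N)`_n| <= d n.
  rewrite coefM; apply: le_trans (ler_norm_sum _ _ _) _.
  apply: (@le_trans _ _ (\sum_(k < n.+1) M ^+ 2)).
    apply: ler_sum => i _; rewrite normrM expr2 !coef_poly.
    by apply: ler_pM => //; case: ifP => _ //; rewrite normr0.
  by rewrite sumr_const card_ord /d mulr_natl.
have low N n : (n < N)%N -> (A N * B N)`_n = c n.
  move=> nN; rewrite coefM; apply: eq_bigr => i _; rewrite !coef_poly.
  by rewrite (leq_ltn_trans (leq_ord i) nN) (leq_ltn_trans (leq_subr i n) nN).
have szAB N : (size (A N * B N)%R <= N + N)%N.
  apply: leq_trans (size_polyMleq _ _) _.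
  by apply: leq_trans (leq_pred _) _; rewrite leq_add// size_poly.
have E N : `|pseries a s N * pseries b s N - pseries c s N| <=
    pseries d `|s| (N + N)%N - pseries d `|s| N.
  rewrite -!hA -hornerM (horner_coef_wide _ (szAB N)).
  rewrite -(big_mkord xpredT (fun i => (A N * B N)`_i * s ^+ i)).
  rewrite (big_cat_nat (leq0n N) (leq_addr N N))/= -/c hA.
  have -> : \sum_(0 <= i < N) (A N * B N)`_i * s ^+ i = pseries c s N.
    by rewrite /pseries /series/=; apply: eq_big_nat => i /andP[_ iN]; rewrite low.
  rewrite addrAC subrr add0r /pseries /series/= [in leRHS](big_cat_nat (leq0n N) (leq_addr N N))/=.
  rewrite [leRHS]addrAC subrr add0r.
  apply: le_trans (ler_norm_sum _ _ _) _; apply: ler_sum => i _.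
  by rewrite normrM normrX ler_wpM2r ?exprn_ge0.
apply: psum_lim.
have cab : (pseries a s \* pseries b s) @ \oo --> psum a s * psum b s.
  by apply: cvgM; exact: psum_cvg.
rewrite -[X in _ --> X]subr0.
have -> : pseries c s = (pseries a s \* pseries b s) \-
    (fun N => pseries a s N * pseries b s N - pseries c s N).
  by apply/funext => N /=; rewrite opprB addrC subrK.
apply: cvgB => //.
apply: norm_cvg0.
apply: (@squeeze_cvgr _ _ _ _ (fun=> 0) (fun N => pseries d `|s| (N + N)%N - pseries d `|s| N)).
- by apply: nearW => N; rewrite normr_ge0 E.
- exact: cvg_cst.
- rewrite -(subrr (limn (pseries d `|s|))); apply: cvgB => //.
  apply: (cvg_comp (fun N => (N + N)%N) _ _ cd).
  apply/cvgnyPge => k; near=> n.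
  by rewrite (@leq_trans n)// ?leq_addr//; near: n; exact: nbhs_infty_ge.
Unshelve. all: by end_near. Qed.

(** Multiplying the [n]-th coefficient by [n] is the operator [s d/ds], which up to the factor [lam]
    is the time derivative once [s = exp (lam t)]. The constant term vanishes, so the series is
    compared after a shift by one. *)
Lemma psum_natmul a s : disk_cvg a -> `|s| < 1 ->
  psum (fun n => n%:R * a n) s = s * psum (pseries_diffs a) s.
Proof.
move=> ca s1; apply: psum_lim; rewrite -cvg_shiftS.
have -> : (fun n => pseries (fun n => n%:R * a n) s n.+1) =
    s \*: pseries (pseries_diffs a) s.
  apply/funext => n; rewrite /pseries /series/= big_nat_recl// !mul0r add0r.
  by rewrite scaler_sumr; apply: eq_bigr => i _; rewrite /pseries_diffs exprS mulrCA.
by apply: cvgZr; apply: psum_cvg => //; exact: disk_cvg_diffs.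
Qed.

Lemma psum0 a : psum a 0 = a 0%N.
Proof.
apply: psum_lim; rewrite -cvg_shiftS.
have -> : (fun n => pseries a 0 n.+1) = cst (a 0%N); last exact: cvg_cst.
apply/funext => n; rewrite /pseries /series/= big_nat_recl//= expr0 mulr1.
by rewrite big1 ?addr0// => i _; rewrite expr0n mulr0.
Qed.

End PowerSeries.

(** * Vector algebra in dimension three *)

Section VectorAlgebra.
Context {R : realType}.
Implicit Types (u v w : 'cV[R]_3) (A M : 'M[R]_3) (k : R).

Lemma dotE u v : dot u v = u 0 0 * v 0 0 + u 1 0 * v 1 0 + u 2 0 * v 2 0.
Proof.
rewrite /dot !big_ord_recl big_ord0 addr0 addrA.
by congr (_ + _ + _); congr (u _ _ * v _ _); exact/val_inj.
Qed.

Lemma col3P u v : u 0 0 = v 0 0 -> u 1 0 = v 1 0 -> u 2 0 = v 2 0 -> u = v.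
Proof.
move=> h0 h1 h2; apply/matrixP => i j; rewrite ord1.
case: i => -[|[|[|//]]] hi.
- by rewrite (_ : Ordinal hi = 0) ?h0//; exact/val_inj.
- by rewrite (_ : Ordinal hi = 1) ?h1//; exact/val_inj.
- by rewrite (_ : Ordinal hi = 2) ?h2//; exact/val_inj.
Qed.

Lemma crossE u v : [/\ (u *x v) 0 0 = u 1 0 * v 2 0 - u 2 0 * v 1 0,
  (u *x v) 1 0 = u 2 0 * v 0 0 - u 0 0 * v 2 0 &
  (u *x v) 2 0 = u 0 0 * v 1 0 - u 1 0 * v 0 0].
Proof.
by split; rewrite mxE; congr (u _ _ * v _ _ - u _ _ * v _ _); exact/val_inj.
Qed.

Let cross0 u v := let: And3 h _ _ := crossE u v in h.
Let cross1 u v := let: And3 _ h _ := crossE u v in h.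
Let cross2 u v := let: And3 _ _ h := crossE u v in h.

Ltac coords :=
  rewrite ?dotE; try apply: col3P;
  rewrite ?(dotE, cross0, cross1, cross2, mxE); ring.

Lemma dotC u v : dot u v = dot v u. Proof. coords. Qed.
Lemma dotDl u v w : dot (u + v) w = dot u w + dot v w. Proof. coords. Qed.
Lemma dotDr u v w : dot u (v + w) = dot u v + dot u w. Proof. coords. Qed.
Lemma dotNl u v : dot (- u) v = - dot u v. Proof. coords. Qed.
Lemma dotNr u v : dot u (- v) = - dot u v. Proof. coords. Qed.
Lemma dotZl k u v : dot (k *: u) v = k * dot u v. Proof. coords. Qed.
Lemma dotZr k u v : dot u (k *: v) = k * dot u v. Proof. coords. Qed.
Lemma dot0v u : dot 0 u = 0. Proof. coords. Qed.
Lemma dotv0 u : dot u 0 = 0. Proof. coords. Qed.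

Lemma crossDl u v w : (u + v) *x w = u *x w + v *x w. Proof. coords. Qed.
Lemma crossDr u v w : u *x (v + w) = u *x v + u *x w. Proof. coords. Qed.
Lemma crossNl u v : (- u) *x v = - (u *x v). Proof. coords. Qed.
Lemma crossNr u v : u *x (- v) = - (u *x v). Proof. coords. Qed.
Lemma crossZl k u v : (k *: u) *x v = k *: (u *x v). Proof. coords. Qed.
Lemma crossZr k u v : u *x (k *: v) = k *: (u *x v). Proof. coords. Qed.
Lemma cross0v u : 0 *x u = 0. Proof. coords. Qed.
Lemma crossv0 u : u *x 0 = 0. Proof. coords. Qed.
Lemma crossvv u : u *x u = 0. Proof. coords. Qed.
Lemma crossC u v : u *x v = - (v *x u). Proof. coords. Qed.
Lemma dot_cross_rot u v w : dot (u *x v) w = dot u (v *x w). Proof. coords. Qed.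
Lemma double_crossl u v w : (u *x v) *x w = dot u w *: v - dot v w *: u.
Proof. coords. Qed.

Lemma cross_eq0 u : u != 0 -> exists v, u *x v != 0.
Proof.
move=> u0; apply: contrapT => h; move/negP: u0; apply; apply/eqP.
have {}h v : u *x v = 0.
  by apply/eqP; apply: contrapT => hv; apply: h; exists v; exact/negP.
pose e i : 'cV[R]_3 := delta_mx i 0.
have E i j : (u *x e i) j 0 = 0 by rewrite h mxE.
(* The chosen entries are minus the third, the first and the second coordinate of [u]. *)
move: (E 1 0) (E 2 1) (E 0 2); rewrite cross0 cross1 cross2 !mxE /=.
rewrite !mulr0 !mulr1 !(subr0, sub0r) => h2 h0 h1.
apply: col3P; rewrite mxE; apply/eqP; rewrite -oppr_eq0; exact/eqP.
Qed.

Lemma dot_mulmxr u A v : dot u (A *m v) = dot (A^T *m u) v.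
Proof.
have dotT x y : dot x y = (x^T *m y) 0 0 :> R.
  by rewrite mxE; apply: eq_bigr => i _; rewrite mxE.
by rewrite !dotT trmx_mul trmxK mulmxA.
Qed.

Lemma dot_ge0 u : 0 <= dot u u.
Proof. by apply: sumr_ge0 => i _; rewrite -expr2 sqr_ge0. Qed.

Lemma dot_eq0 u : (dot u u == 0) = (u == 0).
Proof.
apply/eqP/eqP => [|->]; last exact: dot0v.
move/eqP; rewrite /dot psumr_eq0 => [|i _]; last by rewrite -expr2 sqr_ge0.
move=> /allP h; apply/matrixP => i j; rewrite ord1 mxE; apply/eqP.
by rewrite -sqrf_eq0 expr2; apply: h; rewrite mem_index_enum.
Qed.

Lemma enorm_sq u : enorm u ^+ 2 = dot u u.
Proof. by rewrite sqr_sqrtr// dot_ge0. Qed.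

Lemma enorm_eq1 u : enorm u = 1 <-> dot u u = 1.
Proof.
split=> [h|h]; last by rewrite /enorm h sqrtr1.
by rewrite -enorm_sq h expr1n.
Qed.

Lemma coord_le_norm u i : `|u i 0| <= `|u|.
Proof.
by rewrite [leRHS]/Num.Def.normr/= mx_normrE; exact: (le_bigmax _ _ (i, 0)).
Qed.

Lemma norm_col_le u k : 0 <= k -> (forall i, `|u i 0| <= k) -> `|u| <= k.
Proof.
move=> k0 h; rewrite [leLHS]/Num.Def.normr/= mx_normrE; apply: bigmax_le => //.
by move=> [i j] _ /=; rewrite ord1.
Qed.

Lemma norm_cross_le u v : `|u *x v| <= 2 * (`|u| * `|v|).
Proof.
apply: norm_col_le => [|i]; first by rewrite !mulr_ge0.
rewrite mxE (le_trans (ler_normB _ _))// mulr_natl mulr2n !normrM.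
by rewrite lerD// ler_pM ?coord_le_norm.
Qed.

Lemma norm_dot_le u v : `|dot u v| <= 3 * (`|u| * `|v|).
Proof.
apply: le_trans (ler_norm_sum _ _ _) _.
apply: (@le_trans _ _ (\sum_(i < 3) `|u| * `|v|)).
  by apply: ler_sum => i _; rewrite normrM ler_pM ?coord_le_norm.
by rewrite sumr_const card_ord mulr_natl.
Qed.

Lemma norm_sq_le_dot u : `|u| ^+ 2 <= dot u u.
Proof.
rewrite -enorm_sq ler_pXn2r ?nnegrE ?sqrtr_ge0//.
apply: norm_col_le => [|i]; first exact: sqrtr_ge0.
rewrite -sqrtr_sqr ler_sqrt ?dot_ge0// /dot (bigD1 i)//= -expr2 lerDl.
by apply: sumr_ge0 => j _; rewrite -expr2 sqr_ge0.
Qed.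

Lemma norm_mulmx_le A : exists2 c : R, 0 <= c & forall u, `|A *m u| <= c * `|u|.
Proof.
exists (\sum_i \sum_j `|A i j|).
  by apply: sumr_ge0 => i _; apply: sumr_ge0.
move=> u; apply: norm_col_le => [|i].
  by rewrite mulr_ge0//; apply: sumr_ge0 => i _; apply: sumr_ge0.
rewrite mxE (le_trans (ler_norm_sum _ _ _))//.
apply: (@le_trans _ _ ((\sum_j `|A i j|) * `|u|)).
  rewrite mulr_suml; apply: ler_sum => j _.
  by rewrite normrM ler_wpM2l ?coord_le_norm.
rewrite ler_wpM2r// [leRHS](bigD1 i)//= lerDl.
by apply: sumr_ge0 => k _; apply: sumr_ge0.
Qed.

End VectorAlgebra.

(** * Spectrum of the linearization *)

Section Linear.
Context {R : realType}.
Implicit Types (u v w p q r : 'cV[R]_3) (A J M Q : 'M[R]_3) (k lam : R).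

Lemma continuous_sum (T : topologicalType) n (f : 'I_n -> T -> R) :
  (forall i, continuous (f i)) -> continuous (fun x => \sum_i f i x).
Proof. by move=> fc; apply: (@continuous_big _ _ _ _ xpredT (@add_continuous R^o)). Qed.

Lemma sym_posdef_unit J : sym_posdef J -> J \in unitmx.
Proof.
move=> [Jsym Jpos]; rewrite -row_free_unit -kermx_eq0; apply/eqP/row_matrixP => i.
rewrite row0; set x := row i (kermx J).
have Jx : J *m x^T = 0 by rewrite -[J in LHS]Jsym -trmx_mul /x -row_mul mulmx_ker row0 trmx0.
apply: trmx_inj; rewrite trmx0; apply: contrapT => /eqP/Jpos.
by rewrite Jx dotv0 ltxx.
Qed.

(** The Rayleigh quotient is continuous on the compact unit sphere and homogeneous of degree zero,
    so its maximum there bounds it at every nonzero vector. For symmetric [M] the maximum is the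
    largest eigenvalue of the pencil [M - x J]. *)
Lemma rayleigh_max J M : sym_posdef J -> exists u (kappa : R),
  [/\ u != 0, dot u (M *m u) = kappa * dot u (J *m u) &
      forall v, dot v (M *m v) <= kappa * dot v (J *m v)].
Proof.
move=> [_ Jpos].
(* Row vectors are used because [EVT_max_rV] is stated for them; the sphere is that of the sup
   norm. *)
pose f (x : 'rV[R]_3) := dot x^T (M *m x^T) / dot x^T (J *m x^T).
pose S := [set x : 'rV[R]_3 | `|x| = 1].
have coordc i : continuous (fun x : 'rV[R]_3 => x^T i 0).
  move=> x; rewrite (_ : (fun _ => _) = (fun x : 'rV[R]_3 => x 0 i)).
    exact: coord_continuous.
  by apply/funext => y; rewrite mxE.
have mulc A i : continuous (fun x : 'rV[R]_3 => (A *m x^T) i 0).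
  rewrite (_ : (fun _ => _) = (fun x : 'rV[R]_3 => \sum_j A i j * x^T j 0)).
    have h j : continuous (fun x : 'rV[R]_3 => A i j * x^T j 0).
      move=> x; apply: (@continuousM R 'rV[R]_3 (cst (A i j))); last exact: coordc.
      exact: cst_continuous.
    exact: (continuous_sum _ _ _ h).
  by apply/funext => x; rewrite mxE.
have quadc A : continuous (fun x : 'rV[R]_3 => dot x^T (A *m x^T)).
  have h i : continuous (fun x : 'rV[R]_3 => x^T i 0 * (A *m x^T) i 0).
    by move=> x; apply: (@continuousM R 'rV[R]_3 (fun x => x^T i 0)); [exact: coordc|exact: mulc].
  exact: (continuous_sum _ _ _ h).
have trneq0 (x : 'rV[R]_3) : x != 0 -> x^T != 0.
  by apply: contra_neq => /(congr1 trmx); rewrite trmxK trmx0.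
have Sneq0 (x : 'rV[R]_3) : S x -> x != 0.
  by rewrite /S/= => x1; rewrite -normr_gt0 x1.
have S0 : S !=set0.
  exists (`|const_mx 1 : 'rV[R]_3|^-1 *: const_mx 1).
  rewrite /S/= normrZ normfV normr_id mulVf// normr_eq0.
  by apply/eqP => /matrixP/(_ 0 0); rewrite !mxE => /eqP; rewrite oner_eq0.
have Sc : compact S.
  apply: bounded_closed_compact.
    by exists 1; split=> // z z1 x; rewrite /S/= => ->; exact: ltW.
  apply: (@preimage_closed _ _ (@Num.norm R 'rV[R]_3) [set x | x = 1]).
    by move=> x _; exact: norm_continuous.
  exact: closed_eq.
have fc : {within S, continuous f}.
  apply: continuous_in_subspaceT => x; rewrite inE => xS.
  have Jx : dot x^T (J *m x^T) != 0 by rewrite gt_eqF// Jpos// trneq0// Sneq0.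
  pose q A (y : 'rV[R]_3) := dot y^T (A *m y^T).
  have cV := @continuousV R 'rV[R]_3 (q J) x Jx (quadc J x).
  exact: (@continuousM R 'rV[R]_3 (q M) _ x (quadc M x) cV).
have [x xS fmax] := EVT_max_rV S0 Sc fc.
exists x^T, (f x); move: xS; rewrite inE => xS; have x0 := trneq0 _ (Sneq0 _ xS).
split => // [|v]; first by rewrite /f divfK// gt_eqF// Jpos.
have [->|v0] := eqVneq v 0; first by rewrite !mulmx0 !dotv0 mulr0.
have nv : 0 < `|v^T|.
  by rewrite normr_gt0; apply: contra_neq v0 => /(congr1 trmx); rewrite trmxK trmx0.
have vS : `|v^T|^-1 *: v^T \in S.
  by rewrite inE /S/= normrZ normfV normr_id mulVf// gt_eqF.
have := fmax _ vS; rewrite {1}/f linearZ/= trmxK -!scalemxAr !dotZl !dotZr.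
rewrite !mulrA -mulf_div divff ?mul1r ?ler_pdivrMr ?Jpos//.
by rewrite mulf_neq0// invr_neq0// gt_eqF.
Qed.

(** With [y = Q u], the form at [u - t y] equals [- 2 t |y|^2 + t^2 c], which is negative for small
    [t > 0] unless [y = 0]. *)
Lemma psd_ker Q u : Q^T = Q -> (forall v, 0 <= dot v (Q *m v)) ->
  dot u (Q *m u) = 0 -> Q *m u = 0.
Proof.
move=> Qsym Qpsd Qu0; apply/eqP; rewrite -dot_eq0.
set y := Q *m u; set a := dot y y; set c := dot y (Q *m y).
have c0 : 0 <= c by exact: Qpsd.
have a0 : 0 <= a by exact: dot_ge0.
(* The denominator is [c + 1] because [c] may vanish. Multiplied by [(c + 1)^2], the form becomes
   [- a^2 (c + 2)]. *)
have := Qpsd (u - (a / (c + 1)) *: y).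
rewrite mulmxBr -scalemxAr !(dotDl, dotDr, dotNl, dotNr, dotZl, dotZr) Qu0.
have -> : dot u (Q *m y) = a by rewrite dot_mulmxr Qsym.
rewrite -/y -/a -/c => h.
have c1 : 0 < c + 1 by rewrite ltr_wpDl.
apply/eqP; have := mulr_ge0 (ltW (mulr_gt0 c1 c1)) h.
rewrite (_ : _ * _ = - (a ^+ 2 * (c + 2))); last by field; rewrite gt_eqF.
by nra.
Qed.

(** The matrix [P]: minus the square of the cross product with [r], that is [|r|^2] times the
    orthogonal projection along [r]. *)
Definition sqcrossmx r : 'M[R]_3 := (dot r r)%:M - r *m r^T.

Lemma mul_sqcrossmx r v : sqcrossmx r *m v = - (r *x (r *x v)).
Proof.
rewrite crossC opprK double_crossl mulmxBl mul_scalar_mx -mulmxA.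
congr (_ - _); apply/matrixP => i j; rewrite ord1 !mxE big_ord1 mulrC mxE.
by rewrite dotC /dot; congr (_ * _); apply: eq_bigr => l _; rewrite mxE.
Qed.

Lemma sqcrossmx_sym r : (sqcrossmx r)^T = sqcrossmx r.
Proof. by rewrite /sqcrossmx linearB/= tr_scalar_mx trmx_mul trmxK. Qed.

Lemma dot_sqcrossmx r v : dot v (sqcrossmx r *m v) = dot (r *x v) (r *x v).
Proof. by rewrite mul_sqcrossmx dotNr -dot_cross_rot (crossC v) dotNl opprK. Qed.

(** Eliminating [g] from the two eigenvector equations leaves [lam^2 J w = k P w]. A maximizer [w]
    of the Rayleigh quotient of [P], with maximum [kap], solves it for [lam^2 = k kap]; maximality
    is the bound of [k P] by [lam^2 J]. *)
Lemma unstable_mode J r k : sym_posdef J -> r != 0 -> 0 < k ->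
  exists2 lam : R, 0 < lam &
    (forall v, k * dot v (sqcrossmx r *m v) <= lam ^+ 2 * dot v (J *m v)) /\
    exists g w, [/\ g != 0, lam *: g + r *x w = 0 &
      lam *: (J *m w) - k *: (r *x g) = 0].
Proof.
move=> Jpd r0 k0; have [Jsym Jpos] := Jpd.
have [w [kap [w0 kw kmax]]] := rayleigh_max _ (sqcrossmx r) Jpd.
(* The maximum is positive because [P] is positive at any [v] not parallel to [r]. *)
have kap0 : 0 < kap.
  have [v rv] := cross_eq0 _ r0.
  have v0 : v != 0 by apply: contra_neq rv => ->; rewrite crossv0.
  rewrite -(pmulr_lgt0 _ (Jpos v v0)); apply: lt_le_trans (kmax v).
  by rewrite dot_sqcrossmx lt_neqAle dot_ge0 eq_sym dot_eq0 rv.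
have eigw : kap *: (J *m w) = sqcrossmx r *m w.
  have : (kap *: J - sqcrossmx r) *m w = 0.
    apply: psd_ker.
    - by rewrite linearB linearZ/= Jsym sqcrossmx_sym.
    - by move=> v; rewrite mulmxBl -scalemxAl dotDr dotNr dotZr subr_ge0.
    - by rewrite mulmxBl -scalemxAl dotDr dotNr dotZr kw subrr.
  by rewrite mulmxBl -scalemxAl => /eqP; rewrite subr_eq0 => /eqP.
pose lam := Num.sqrt (k * kap).
have lam0 : 0 < lam by rewrite sqrtr_gt0 mulr_gt0.
have lamE : lam ^+ 2 = k * kap by rewrite sqr_sqrtr// ltW// mulr_gt0.
exists lam => //; split=> [v|]; first by rewrite lamE -mulrA ler_pM2l.
have second : lam *: (J *m w) - k *: (r *x (- lam^-1 *: (r *x w))) = 0.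
  rewrite crossZr scaleNr scalerN opprK -[r *x (r *x w)]opprK -mul_sqcrossmx -eigw.
  rewrite !scalerN !scalerA -scalerBl mulrAC -lamE.
  by rewrite (_ : _ - _ = 0) ?scale0r//; field; rewrite gt_eqF.
exists (- lam^-1 *: (r *x w)), w; split=> //.
- apply/eqP => g0; move: second; rewrite g0 crossv0 scaler0 subr0 => /eqP.
  rewrite scaler_eq0 gt_eqF//= => /eqP Jw0.
  by have := Jpos w w0; rewrite Jw0 dotv0 ltxx.
- by rewrite scalerA mulrN mulfV ?gt_eqF// scaleN1r addNr.
Qed.

(* Eliminating [g] leaves [(mu^2 J - k P) w = mu q + k (r *x p)] with
   [mu = n lam] and [P = sqcrossmx r]; as [k P <= lam^2 J] and [mu >= 2 lam],
   the matrix dominates [(3/4) mu^2 J]. *)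
Lemma resolvent J r k lam : sym_posdef J -> 0 < k -> 0 < lam ->
  (forall v, k * dot v (sqcrossmx r *m v) <= lam ^+ 2 * dot v (J *m v)) ->
  exists2 C : R, 0 < C & forall n, (2 <= n)%N -> forall p q, exists g w,
    [/\ (n%:R * lam) *: g + r *x w = p,
        (n%:R * lam) *: (J *m w) - k *: (r *x g) = q,
        `|g| <= C / n%:R * (`|p| + `|q|) & `|w| <= C / n%:R * (`|p| + `|q|)].
Proof.
move=> Jpd k0 lam0 hlam; have [Jsym Jpos] := Jpd.
(* The quotient for the identity matrix gives [|v|^2 <= K1 (v . J v)], a lower bound on [J]. *)
have [u0 [K1 [u0n0 u0E]]] := rayleigh_max _ 1%:M Jpd.
rewrite mul1mx in u0E => hK1.
have K10 : 0 < K1.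
  by rewrite -(pmulr_lgt0 _ (Jpos _ u0n0)) -u0E lt_neqAle dot_ge0 eq_sym dot_eq0 u0n0.
(* [c1] and [c2] will bound [mu |w|] and [mu |g|] by multiples of [|p| + |q|]. In [c1], [4 K1] comes
   from the coercivity of [A], whose factor 3 cancels that of [norm_dot_le], and the bracket bounds
   the right-hand side divided by [mu]. *)
pose c1 := 4 * K1 * (1 + 2 * k * `|r| / lam).
pose c2 := 1 + 2 * `|r| * c1 / lam.
have c10 : 0 < c1.
  have h : 0 <= 2 * k * `|r| / lam.
    by apply: divr_ge0 (ltW lam0); rewrite mulr_ge0// mulr_ge0// ltW.
  by rewrite /c1 !mulr_gt0//; lra.
have c20 : 0 < c2.
  have h : 0 <= 2 * `|r| * c1 / lam.
    by apply: divr_ge0 (ltW lam0); rewrite mulr_ge0 ?(ltW c10)// mulr_ge0.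
  by rewrite /c2; lra.
exists ((c1 + c2) / lam) => [|n n2 p q]; first by rewrite divr_gt0// addr_gt0.
have n2R : 2 <= n%:R :> R by rewrite ler_nat.
have n0 : 0 < n%:R :> R by lra.
set mu := n%:R * lam.
have mu2 : 2 * lam <= mu by rewrite ler_pM2r.
have mu0 : 0 < mu by rewrite mulr_gt0.
pose A := mu ^+ 2 *: J - k *: sqcrossmx r.
have coer v : 3 * mu ^+ 2 * `|v| ^+ 2 <= 4 * K1 * dot v (A *m v).
  have vJv : `|v| ^+ 2 <= K1 * dot v (J *m v).
    by apply: le_trans (norm_sq_le_dot v) _; have := hK1 v; rewrite mul1mx.
  have Jv0 : 0 <= dot v (J *m v).
    by have [->|/Jpos/ltW//] := eqVneq v 0; rewrite dot0v.
  rewrite mulmxBl -!scalemxAl dotDr dotNr !dotZr.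
  have h1 := hlam v.
  have h2 : 4 * lam ^+ 2 <= mu ^+ 2 by nra.
  have h3 : lam ^+ 2 * dot v (J *m v) * 4 <= mu ^+ 2 * dot v (J *m v) by nra.
  have h4 : 3 * mu ^+ 2 * dot v (J *m v) <=
      4 * (mu ^+ 2 * dot v (J *m v) - k * dot v (sqcrossmx r *m v)) by lra.
  have : 3 * mu ^+ 2 * `|v| ^+ 2 <= 3 * mu ^+ 2 * (K1 * dot v (J *m v)).
    by rewrite ler_wpM2l// mulr_ge0// exprn_ge0// ltW.
  by move: h4; rewrite -(ler_pM2l K10); lra.
have Aunit : A \in unitmx.
  apply: sym_posdef_unit; split=> [|v v0].
    by rewrite /A linearB/= !linearZ/= Jsym sqcrossmx_sym.
  have K14 : 0 < 4 * K1 by rewrite mulr_gt0.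
  rewrite -(pmulr_rgt0 _ K14); apply: lt_le_trans (coer v).
  by rewrite !mulr_gt0 ?exprn_gt0 ?normr_gt0.
pose rhs := mu *: q + k *: (r *x p).
pose w := invmx A *m rhs.
have Aw : A *m w = rhs by rewrite mulmxA mulmxV// mul1mx.
pose g := mu^-1 *: (p - r *x w).
have N0 : 0 <= `|p| + `|q| by rewrite addr_ge0.
have rhs_le : `|rhs| <= mu * ((1 + 2 * k * `|r| / lam) * (`|p| + `|q|)).
  apply: (@le_trans _ _ (mu * `|q| + k * (2 * (`|r| * `|p|)))).
    apply: le_trans (ler_normD _ _) _; rewrite !normrZ !gtr0_norm// lerD2l.
    by rewrite ler_pM2l// norm_cross_le.
  have -> : mu * ((1 + 2 * k * `|r| / lam) * (`|p| + `|q|)) =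
      mu * (`|p| + `|q|) + k * (2 * (`|r| * (`|p| + `|q|))) * (mu / lam).
    by field; rewrite gt_eqF.
  rewrite lerD//; first by rewrite ler_pM2l// lerDr.
  rewrite -[leLHS]mulr1 ler_pM//.
  - by rewrite mulr_ge0 ?mulr_ge0// ltW.
  - by rewrite ler_pM2l// ler_pM2l// ler_wpM2l// lerDl.
  - by rewrite ler_pdivlMr// mul1r; lra.
have w_le : mu * `|w| <= c1 * (`|p| + `|q|).
  have := coer w; rewrite Aw => h.
  have h1 : dot w rhs <= 3 * (`|w| * `|rhs|) := le_trans (ler_norm _) (norm_dot_le _ _).
  have [->|w0] := eqVneq w 0; first by rewrite normr0 mulr0 mulr_ge0// ltW.
  have wp : 0 < `|w| by rewrite normr_gt0.
  (* Coercivity at [w] and the bound on [w . rhs] give the claim multiplied by [3 |w| mu], a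
     positive factor that is then cancelled. *)
  have h2 : (3 * `|w| * mu) * (mu * `|w|) <= (3 * `|w| * mu) * (c1 * (`|p| + `|q|)).
    apply: (@le_trans _ _ (4 * K1 * (3 * (`|w| * `|rhs|)))).
      apply: le_trans (_ : _ <= 4 * K1 * dot w rhs) _; last first.
        by rewrite ler_pM2l// mulr_gt0.
      by apply: le_trans h; rewrite le_eqVlt; apply/orP; left; apply/eqP; ring.
    have -> : 3 * `|w| * mu * (c1 * (`|p| + `|q|)) = 4 * K1 * (3 * (`|w| *
        (mu * ((1 + 2 * k * `|r| / lam) * (`|p| + `|q|))))).
      by rewrite /c1; field; rewrite gt_eqF.
    by rewrite ler_pM2l ?mulr_gt0// ler_pM2l// ler_pM2l.
  by move: h2; rewrite ler_pM2l// !mulr_gt0.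
have g_le : mu * `|g| <= c2 * (`|p| + `|q|).
  rewrite normrZ normfV gtr0_norm// mulrA divff ?gt_eqF// mul1r.
  apply: le_trans (ler_normB _ _) _.
  have h := norm_cross_le r w.
  have h1 : `|w| <= c1 / lam * (`|p| + `|q|).
    rewrite mulrAC ler_pdivlMr//; apply: le_trans w_le.
    by rewrite mulrC ler_wpM2r//; lra.
  have h2 : `|r| * `|w| <= `|r| * (c1 / lam * (`|p| + `|q|)) by rewrite ler_wpM2l.
  have -> : c2 * (`|p| + `|q|) =
      (`|p| + `|q|) + 2 * (`|r| * (c1 / lam * (`|p| + `|q|))).
    by rewrite /c2; field; rewrite gt_eqF.
  by have := normr_ge0 q; lra.
have fin (x : 'cV[R]_3) (c : R) : c <= c1 + c2 -> mu * `|x| <= c * (`|p| + `|q|) ->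
    `|x| <= (c1 + c2) / lam / n%:R * (`|p| + `|q|).
  move=> cc hx; rewrite -(ler_pM2l mu0).
  have -> : mu * ((c1 + c2) / lam / n%:R * (`|p| + `|q|)) = (c1 + c2) * (`|p| + `|q|).
    by rewrite /mu; field; rewrite !gt_eqF.
  by apply: le_trans hx _; rewrite ler_wpM2r.
exists g, w; split.
- by rewrite scalerA mulfV ?gt_eqF// scale1r subrK.
- have e1 : k *: (r *x g) = mu^-1 *: (k *: (r *x p) + k *: (sqcrossmx r *m w)).
    rewrite crossZr crossDr crossNr mul_sqcrossmx -scalerDr.
    by rewrite scalerA mulrC -scalerA.
  have e2 : mu *: (J *m w) = mu^-1 *: (mu ^+ 2 *: (J *m w)).
    by rewrite scalerA; congr (_ *: _); field; rewrite gt_eqF.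
  have := Aw; rewrite mulmxBl -!scalemxAl => /eqP; rewrite subr_eq => /eqP e3.
  rewrite e2 e1 e3 -scalerBr /rhs -[X in X - _]addrA addrK.
  by rewrite scalerA mulVf ?gt_eqF// scale1r.
- by apply: fin g_le; rewrite lerDr ltW.
- by apply: fin w_le; rewrite lerDl ltW.
Qed.

End Linear.

(** Course-of-values recursion: [b n] lists the first [n] values, and [nth] turns the list into a
    function that agrees with the sequence below [n], where [F n] looks. *)
Lemma strong_rec (T : Type) (x0 : T) (F : nat -> (nat -> T) -> T) :
  (forall n u v, (forall i, (i < n)%N -> u i = v i) -> F n u = F n v) ->
  exists a, forall n, a n = F n a.
Proof.
move=> Fext.
pose fix b n := if n is n'.+1 then rcons (b n') (F n' (nth x0 (b n'))) else [::].
have szb n : size (b n) = n by elim: n => //= n IH; rewrite size_rcons IH.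
have bE m n : (m < n)%N -> nth x0 (b n) m = nth x0 (b m.+1) m.
  elim: n => // n IH; rewrite ltnS leq_eqVlt => /orP[/eqP->//|mn].
  by rewrite [LHS]/= nth_rcons szb mn IH.
exists (fun n => nth x0 (b n.+1) n) => n.
rewrite /= nth_rcons szb ltnn eqxx; apply: Fext => i ni.
by rewrite bE.
Qed.

(** * Taylor coefficients of the unstable manifold *)

Section Coefficients.
Context {R : realType}.
Implicit Types (J : 'M[R]_3) (r : 'cV[R]_3) (k : R).

(** The Cauchy product: coefficients of the cross product of two vector power series. *)
Definition cross_conv (u v : nat -> 'cV[R]_3) n := \sum_(i < n.+1) u i *x v (n - i)%N.

(** The recursion has to use the inner sum, in which the [n]-th coefficients do not occur; the two
    outer terms vanish with the constant coefficients. *)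
Lemma inner_cross_conv (u v : nat -> 'cV[R]_3) n : u 0%N = 0 -> v 0%N = 0 ->
  \sum_(i < n.+1 | (0 < i < n)%N) u i *x v (n - i)%N = cross_conv u v n.
Proof.
move=> u0 v0; rewrite /cross_conv big_mkcond; apply: eq_bigr => i _.
case: ifP => // /negbT; rewrite negb_and -eqn0Ngt -leqNgt => /orP[/eqP->|ni].
  by rewrite u0 cross0v.
by rewrite (eqP (ni : (n - i == 0)%N)) v0 crossv0.
Qed.

(** One factor 2 of the 4 comes from [norm_cross_le], the other from [n + 1 <= 2 n] for the number
    of terms. *)
Lemma norm_cross_conv_le (u v : nat -> 'cV[R]_3) (A B : R) n :
  0 <= A -> 0 <= B -> (0 < n)%N -> u 0%N = 0 -> v 0%N = 0 ->
  (forall i, (i < n)%N -> `|u i| <= A) -> (forall i, (i < n)%N -> `|v i| <= B) ->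
  `|cross_conv u v n| <= n%:R * (4 * (A * B)).
Proof.
move=> A0 B0 n0 u0 v0 uA vB; rewrite -inner_cross_conv//.
apply: le_trans (ler_norm_sum _ _ _) _.
apply: (@le_trans _ _ (\sum_(i < n.+1 | (0 < i < n)%N) 2 * (A * B))).
  apply: ler_sum => i /andP[i0 iN]; apply: le_trans (norm_cross_le _ _) _.
  by rewrite ler_wpM2l// ler_pM ?uA ?vB// ltn_subrL i0.
rewrite big_mkcond; apply: (@le_trans _ _ (\sum_(i < n.+1) 2 * (A * B))).
  by apply: ler_sum => i _; case: ifP => // _; rewrite !mulr_ge0.
rewrite sumr_const card_ord -[leLHS]mulr_natl.
have -> : n%:R * (4 * (A * B)) = n.*2%:R * (2 * (A * B)).
  by rewrite -mul2n natrM; ring.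
by rewrite ler_wpM2r ?mulr_ge0// ler_nat -addnn -addn1 leq_add2l.
Qed.

(* [M] is chosen so that a bound by [M] on the lower coefficients reproduces
   itself through [resolvent]: the [n] terms of the convolution compensate the
   factor [1 / n]. *)
Lemma unstable_manifold_coefs J r k : sym_posdef J -> r != 0 -> 0 < k ->
  exists (lam M : R) (g w : nat -> 'cV[R]_3),
  [/\ 0 < lam, g 0%N = 0 /\ w 0%N = 0, g 1%N != 0,
      forall n, `|g n| <= M /\ `|w n| <= M &
      forall n, (n%:R * lam) *: g n + r *x w n = cross_conv g w n /\
        (n%:R * lam) *: (J *m w n) - k *: (r *x g n) =
          cross_conv (fun i => J *m w i) w n].
Proof.
move=> Jpd r0 k0.
have [lam lam0 [hlam [g1 [w1 [g10 mode1 mode2]]]]] := unstable_mode _ _ _ Jpd r0 k0.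
have [C C0 res] := resolvent _ _ _ _ Jpd k0 lam0 hlam.
have [c c0 hc] := norm_mulmx_le J.
(* [M] solves [4 C (1 + c) M^2 = M], the equality that closes the induction on the bounds. *)
pose M := (4 * C * (1 + c))^-1.
have c1 : 0 < 1 + c by rewrite ltr_pwDl.
have M0 : 0 < M by rewrite invr_gt0 !mulr_gt0.
have gw0 : 0 < `|g1| + `|w1| by rewrite ltr_pwDl// normr_gt0.
(* The equations of order one are homogeneous, so the eigenvector may be scaled by [t] to meet the
   bound [M]. *)
have [t t0 tM] : exists2 t, 0 < t & forall x : R, x <= `|g1| + `|w1| -> t * x <= M.
  exists (M / (`|g1| + `|w1|)); first by rewrite divr_gt0.
  by move=> x hx; rewrite mulrAC ler_pdivrMr// ler_pM2l.
pose V := 'cV[R]_3.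
have [sol hsol] : exists sol : nat * V * V -> V * V, forall x, (2 <= x.1.1)%N ->
    [/\ (x.1.1%:R * lam) *: (sol x).1 + r *x (sol x).2 = x.1.2,
        (x.1.1%:R * lam) *: (J *m (sol x).2) - k *: (r *x (sol x).1) = x.2,
        `|(sol x).1| <= C / x.1.1%:R * (`|x.1.2| + `|x.2|) &
        `|(sol x).2| <= C / x.1.1%:R * (`|x.1.2| + `|x.2|)].
  have /choice[sol hsol] : forall x : nat * V * V, exists y : V * V, (2 <= x.1.1)%N ->
    [/\ (x.1.1%:R * lam) *: y.1 + r *x y.2 = x.1.2,
        (x.1.1%:R * lam) *: (J *m y.2) - k *: (r *x y.1) = x.2,
        `|y.1| <= C / x.1.1%:R * (`|x.1.2| + `|x.2|) &
        `|y.2| <= C / x.1.1%:R * (`|x.1.2| + `|x.2|)].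
    (* Below order two, where [resolvent] gives nothing, the value is set to [(0, 0)]. *)
    move=> [[n p] q] /=; have [n2|] := boolP (2 <= n)%N; last by exists (0, 0).
    by have [g [w h]] := res n n2 p q; exists (g, w).
  by exists sol.
pose F n (a : nat -> V * V) : V * V :=
  if n is n'.+1 then
    if n' is 0 then (t *: g1, t *: w1) else
    sol (n, \sum_(i < n.+1 | (0 < i < n)%N) (a i).1 *x (a (n - i)%N).2,
            \sum_(i < n.+1 | (0 < i < n)%N) (J *m (a i).2) *x (a (n - i)%N).2)
  else (0, 0).
have [a aE] : exists a, forall n, a n = F n a.
  apply: strong_rec; first exact: (0, 0).
  move=> [|[|n]] u v uv //; rewrite /F.
  congr (sol (_, _, _)); apply: eq_bigr => i /andP[i0 iN];
  by rewrite (uv _ iN) uv// ltn_subrL i0.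
have a0 : a 0%N = (0, 0) by rewrite aE.
have a1 : a 1%N = (t *: g1, t *: w1) by rewrite aE.
pose conv_data n := (n, cross_conv (fun i => (a i).1) (fun i => (a i).2) n,
  cross_conv (fun i => J *m (a i).2) (fun i => (a i).2) n).
have aS n : a n.+2 = sol (conv_data n.+2).
  by rewrite aE; congr (sol (_, _, _)); apply: inner_cross_conv; rewrite a0 ?mulmx0.
have aM n : `|(a n).1| <= M /\ `|(a n).2| <= M.
  elim/ltn_ind: n => -[|[|n]] IH.
  - by rewrite a0 !normr0; split; exact: ltW.
  - by rewrite a1 /= !normrZ (gtr0_norm t0); split; apply: tM; rewrite ?lerDl ?lerDr.
  have IH1 i : (i < n.+2)%N -> `|(a i).1| <= M by move=> /IH[].
  have IH2 i : (i < n.+2)%N -> `|(a i).2| <= M by move=> /IH[].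
  have IHJ i : (i < n.+2)%N -> `|J *m (a i).2| <= c * M.
    by move=> /IH2 h; apply: le_trans (hc _) _; rewrite ler_wpM2l.
  have n0 : 0 < n.+2%:R :> R by rewrite ltr0n.
  have [_ _ hg hw] := hsol (conv_data n.+2) isT.
  rewrite -aS /= in hg hw.
  set p := cross_conv _ _ _ in hg hw; set q := cross_conv (fun i => J *m _) _ _ in hg hw.
  have hp : `|p| <= n.+2%:R * (4 * (M * M)).
    by apply: norm_cross_conv_le; rewrite ?a0 ?(ltW M0).
  have hq : `|q| <= n.+2%:R * (4 * (c * M * M)).
    by apply: norm_cross_conv_le; rewrite ?a0 ?mulmx0 ?mulr_ge0 ?(ltW M0).
  suff hM : C / n.+2%:R * (`|p| + `|q|) <= M by split; [apply: le_trans hg _|apply: le_trans hw _].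
  apply: (@le_trans _ _ (C / n.+2%:R * (n.+2%:R * (4 * (M * M)) + n.+2%:R * (4 * (c * M * M))))).
    by apply: ler_wpM2l; [rewrite divr_ge0 ?ltW|exact: lerD].
  rewrite le_eqVlt; apply/orP; left; apply/eqP.
  by move: n0; rewrite /M; set N := n.+2%:R => n0; field; rewrite !gt_eqF.
exists lam, M, (fun n => (a n).1), (fun n => (a n).2); split=> //.
- by rewrite a0.
- by rewrite a1/= scaler_eq0 negb_or (gt_eqF t0).
(* At orders zero and one the convolutions vanish with [a 0]; at order one the left-hand sides are
   [t] times the eigenvector equations. *)
move=> [|[|n]].
- rewrite /cross_conv !big_ord1 a0 /= !mulmx0 !crossv0 !scaler0 addr0 subrr.
  by [].
- rewrite /cross_conv !big_ord_recl !big_ord0 /= a1 !a0 /=.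
  rewrite !mulmx0 !cross0v ?crossv0 !mul1r !addr0.
  rewrite !crossZr -!scalemxAr.
  rewrite !scalerA ![_ * t]mulrC -!scalerA -scalerDr -scalerBr mode1 mode2.
  by rewrite !scaler0.
- have := hsol (conv_data n.+2) isT.
  by rewrite -aS => -[].
Qed.
End Coefficients.

(** * Vector-valued power series *)

Section VectorSeries.
Context {R : realType}.
Implicit Types (a b : nat -> 'cV[R]_3) (A : 'M[R]_3) (s k M : R).

Lemma disk_cvg_lincomb m (c : 'I_m -> R) (u : 'I_m -> R^nat) :
  (forall j, disk_cvg (u j)) -> disk_cvg (fun n => \sum_j c j * u j n).
Proof.
elim: m c u => [|m IH] c u cu.
  by apply: (@bounded_disk_cvg _ _ 0) => n; rewrite big_ord0 normr0.
under eq_fun do rewrite big_ord_recl.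
by apply: disk_cvgD; [exact: disk_cvgZ|exact: IH].
Qed.

Lemma psum_lincomb m (c : 'I_m -> R) (u : 'I_m -> R^nat) s :
  (forall j, disk_cvg (u j)) -> `|s| < 1 ->
  psum (fun n => \sum_j c j * u j n) s = \sum_j c j * psum (u j) s.
Proof.
move=> cu s1; elim: m c u cu => [|m IH] c u cu.
  rewrite big_ord0; apply: psum_lim.
  rewrite (_ : pseries _ s = cst 0); first exact: cvg_cst.
  apply/funext => n; rewrite /pseries /series/= big1// => i _.
  by rewrite big_ord0 mul0r.
rewrite big_ord_recl -IH// -psumZ// -psumD//.
- by congr psum; apply/funext => n; rewrite big_ord_recl.
- exact: disk_cvgZ.
- exact: disk_cvg_lincomb.
Qed.

Definition vdisk_cvg a := forall i, disk_cvg (fun n => a n i 0).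

Definition vpsum a s : 'cV[R]_3 := \col_i psum (fun n => a n i 0) s.

Definition vdiffs a n : 'cV[R]_3 := n.+1%:R *: a n.+1.

Lemma bounded_vdisk_cvg a M : (forall n, `|a n| <= M) -> vdisk_cvg a.
Proof.
by move=> aM i; apply: (bounded_disk_cvg _ M) => n; apply: le_trans (coord_le_norm _ _) (aM n).
Qed.

Lemma vdisk_cvg_natmul a M : (forall n, `|a n| <= M) ->
  vdisk_cvg (fun n => n%:R *: a n).
Proof.
move=> aM i; apply: le_disk_cvg (disk_cvg_natmul M) => n.
rewrite mxE normrM normr_nat ler_pM ?ler_nat//.
by apply: le_trans (coord_le_norm _ _) (aM n).
Qed.

Lemma vdisk_cvg_mulmx A a : vdisk_cvg a -> vdisk_cvg (fun n => A *m a n).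
Proof.
move=> ca i; under eq_fun do rewrite mxE.
exact: disk_cvg_lincomb.
Qed.

Lemma vpsum_mulmx A a s : vdisk_cvg a -> `|s| < 1 ->
  vpsum (fun n => A *m a n) s = A *m vpsum a s.
Proof.
move=> ca s1; apply/matrixP => i j; rewrite !mxE.
under [X in psum X]eq_fun do rewrite mxE.
rewrite psum_lincomb//; by apply: eq_bigr => l _; rewrite mxE.
Qed.

Lemma vpsumD a b s : vdisk_cvg a -> vdisk_cvg b -> `|s| < 1 ->
  vpsum (fun n => a n + b n) s = vpsum a s + vpsum b s.
Proof.
move=> ca cb s1; apply/matrixP => i j; rewrite !mxE -psumD//.
by congr psum; apply/funext => n; rewrite mxE.
Qed.

Lemma vpsum_cross_conv a b M s :
  (forall n, `|a n| <= M) -> (forall n, `|b n| <= M) -> `|s| < 1 ->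
  vpsum (cross_conv a b) s = vpsum a s *x vpsum b s.
Proof.
move=> aM bM s1; apply/matrixP => i j; rewrite ord1 !mxE.
have h (u : nat -> 'cV[R]_3) l : (forall n, `|u n| <= M) -> forall n, `|u n l 0| <= M.
  by move=> uM n; apply: le_trans (coord_le_norm _ _) (uM n).
have cab l l' : disk_cvg (fun n => \sum_(k < n.+1) a k l 0 * b (n - k)%N l' 0).
  exact: (disk_cvgM (fun n => a n l 0) (fun n => b n l' 0) M (h a l aM) (h b l' bM)).
have psab l l' : psum (fun n => a n l 0) s * psum (fun n => b n l' 0) s =
    psum (fun n => \sum_(k < n.+1) a k l 0 * b (n - k)%N l' 0) s.
  by rewrite -(psumM (fun n => a n l 0) (fun n => b n l' 0) M _ (h a l aM) (h b l' bM)).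
rewrite !psab -[X in _ - X]mul1r -mulNr -psumZ//.
rewrite -psumD//; last exact: disk_cvgZ.
congr psum; apply/funext => n; rewrite /cross_conv summxE mulN1r -sumrB.
by apply: eq_bigr => l _; rewrite mxE.
Qed.

Lemma vpsum0 a : vpsum a 0 = a 0%N.
Proof. by apply/matrixP => i j; rewrite ord1 mxE psum0. Qed.

Lemma vpsum_natmul a s : vdisk_cvg a -> `|s| < 1 ->
  vpsum (fun n => n%:R *: a n) s = s *: vpsum (vdiffs a) s.
Proof.
move=> ca s1; apply/matrixP => i j; rewrite !mxE.
have -> : (fun n => vdiffs a n i 0) = pseries_diffs (fun n => a n i 0).
  by apply/funext => n; rewrite mxE.
rewrite -psum_natmul//.
by congr psum; apply/funext => n; rewrite mxE.
Qed.

Lemma is_derive_mx m n (u : R -> 'M[R]_(m, n)) s (du : 'M[R]_(m, n)) :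
  (forall i j, is_derive s 1 (fun t => u t i j) (du i j)) -> is_derive s 1 u du.
Proof.
move=> h; have du' : derivable u s 1 by apply/derivable_mxP => i j; have [] := h i j.
split=> //; rewrite derive_mx//; apply/matrixP => i j; rewrite mxE.
by have [] := h i j.
Qed.

Lemma is_derive_coord m n (u : R -> 'M[R]_(m, n)) s (du : 'M[R]_(m, n)) i j :
  is_derive s 1 u du -> is_derive s 1 (fun t => u t i j) (du i j).
Proof.
move=> [du' <-]; split; first by move/derivable_mxP: du'; apply.
by rewrite derive_mx// mxE.
Qed.

Lemma vpsum_is_derive a s : vdisk_cvg a -> `|s| < 1 ->
  is_derive s 1 (vpsum a) (vpsum (vdiffs a) s).
Proof.
move=> ca s1; apply: is_derive_mx => i j.
rewrite (_ : (fun t => _) = psum (fun n => a n i 0)); last first.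
  by apply/funext => t; rewrite mxE.
rewrite mxE (_ : (fun n => vdiffs a n i 0) = pseries_diffs (fun n => a n i 0)).
  exact: psum_is_derive.
by apply/funext => n; rewrite mxE.
Qed.

(** As a matrix, the cross product with [r] gives both coefficient equations the shape
    [n lam A a + B b], so that they are summed by one argument. *)
Definition crossmx (r : 'cV[R]_3) : 'M[R]_3 := \matrix_(i, j) (r *x delta_mx j 0) i 0.

Lemma mul_crossmx r v : crossmx r *m v = r *x v.
Proof.
apply/matrixP => i j; rewrite ord1 !mxE.
under eq_bigr do rewrite !mxE !eqxx !andbT mulrBl -!mulrA.
rewrite sumrB; congr (_ - _).
  rewrite (bigD1 (i + 2))//= eqxx mul1r big1 ?addr0// => l /negbTE.
  by rewrite eq_sym => ->; rewrite mul0r mulr0.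
rewrite (bigD1 (i + 1))//= eqxx mul1r big1 ?addr0// => l /negbTE.
by rewrite eq_sym => ->; rewrite mul0r mulr0.
Qed.

(** Summing the coefficient equations turns the factor [n] into [s d/ds] and the convolutions into
    products. The derivative [dG 0] is the coefficient [g 1], hence nonzero. *)
Lemma unstable_manifold (J : 'M[R]_3) r k : sym_posdef J -> r != 0 -> 0 < k ->
  exists (lam : R) (G W dG dW : R -> 'cV[R]_3),
  [/\ 0 < lam, G 0 = 0 /\ W 0 = 0, dG 0 != 0,
      forall s, `|s| < 1 -> is_derive s 1 G (dG s) /\ is_derive s 1 W (dW s) &
      forall s, `|s| < 1 ->
        (s * lam) *: dG s = (G s - r) *x W s /\
        (s * lam) *: (J *m dW s) = (J *m W s) *x W s + k *: (r *x G s)].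
Proof.
move=> Jpd r0 k0.
have [lam [M [g [w [lam0 [g00 w00] g10 gwM eqs]]]]] :=
  unstable_manifold_coefs _ _ _ Jpd r0 k0.
have gM n : `|g n| <= M by have [] := gwM n.
have wM n : `|w n| <= M by have [] := gwM n.
have [c c0 hc] := norm_mulmx_le J.
have M0 : 0 <= M by apply: le_trans (gM 0%N).
(* [vpsum_cross_conv] takes one bound for both factors; [(1 + c) M] serves for [w n] and [J *m w n]
   alike. *)
have M'1 : M <= (1 + c) * M by rewrite ler_peMl// lerDl.
have JwM n : `|J *m w n| <= (1 + c) * M.
  apply: le_trans (hc _) _; apply: ler_pM => //.
  by rewrite lerDr.
have wM' n : `|w n| <= (1 + c) * M by apply: le_trans (wM n) _.
have cg := bounded_vdisk_cvg _ _ gM; have cw := bounded_vdisk_cvg _ _ wM.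
have cng := vdisk_cvg_natmul _ _ gM; have cnw := vdisk_cvg_natmul _ _ wM.
exists lam, (vpsum g), (vpsum w), (vpsum (vdiffs g)), (vpsum (vdiffs w)); split=> //.
- by rewrite !vpsum0.
- by rewrite vpsum0 /vdiffs scale1r.
- by move=> s s1; split; exact: vpsum_is_derive.
move=> s s1.
have key a : vdisk_cvg a -> vdisk_cvg (fun n => n%:R *: a n) ->
    forall A B b, vdisk_cvg b ->
    vpsum (fun n => (n%:R * lam) *: (A *m a n) + B *m b n) s =
    (s * lam) *: (A *m vpsum (vdiffs a) s) + B *m vpsum b s.
  move=> ca cna A B b cb.
  have -> : (fun n => (n%:R * lam) *: (A *m a n) + B *m b n) =
      (fun n => (lam *: A) *m (n%:R *: a n) + B *m b n).
    by apply/funext => n; rewrite -scalemxAr -scalemxAl scalerA.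
  rewrite vpsumD//; [|exact: vdisk_cvg_mulmx..].
  rewrite !vpsum_mulmx// vpsum_natmul//.
  by rewrite -scalemxAr -scalemxAl scalerA.
split.
- have := key g cg cng 1%:M (crossmx r) w cw.
  rewrite !mul1mx mul_crossmx.
  have -> : (fun n => (n%:R * lam) *: (1%:M *m g n) + crossmx r *m w n) = cross_conv g w.
    by apply/funext => n; rewrite mul1mx mul_crossmx; have [] := eqs n.
  rewrite (vpsum_cross_conv _ _ _ _ gM wM s1) => h.
  by rewrite crossDl crossNl h addrK.
- have := key w cw cnw J (- (k *: crossmx r)) g cg.
  rewrite mulNmx -scalemxAl mul_crossmx.
  have -> : (fun n => (n%:R * lam) *: (J *m w n) + - (k *: crossmx r) *m g n) =
      cross_conv (fun n => J *m w n) w.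
    by apply/funext => n; rewrite mulNmx -scalemxAl mul_crossmx; have [] := eqs n.
  rewrite (vpsum_cross_conv _ _ _ _ JwM wM' s1) vpsum_mulmx// => h.
  by rewrite h subrK.
Qed.

End VectorSeries.

(** * Derivatives of vector-valued functions *)

Section Derivatives.
Context {R : realType}.

Lemma cvg_is_derive (U : normedModType R) (f : R -> U) (a : R) (l : U) :
  h^-1 *: ((f \o shift a) (h *: 1) - f a) @[h --> 0^'] --> l -> is_derive a 1 f l.
Proof. by move=> fl; split; [apply/cvg_ex; exists l|exact: cvg_lim]. Qed.

Lemma is_derive_cvg (U : normedModType R) (f : R -> U) (a : R) (l : U) :
  is_derive a 1 f l -> h^-1 *: ((f \o shift a) (h *: 1) - f a) @[h --> 0^'] --> l.
Proof. by move=> [fd <-]. Qed.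

Lemma is_derive_pair (U V : normedModType R) (f : R -> U) (g : R -> V) (a : R) df dg :
  is_derive a 1 f df -> is_derive a 1 g dg ->
  is_derive a 1 (fun t => (f t, g t)) (df, dg).
Proof.
move=> /is_derive_cvg fd /is_derive_cvg gd; apply: cvg_is_derive.
exact: (cvg_pair fd gd).
Qed.

Lemma is_derive_continuous (U : normedModType R) (f : R -> U) (a : R) df :
  is_derive a 1 f df -> {for a, continuous f}.
Proof. by move=> [fd _]; apply/differentiable_continuous/derivable1_diffP. Qed.

Lemma is_derive_comp_real (U : normedModType R) (f : R -> U) (g : R -> R) (a dg : R) df :
  is_derive (g a) 1 f df -> is_derive a 1 g dg ->
  is_derive a 1 (f \o g) (dg *: df).
Proof.
move=> [fd fE] [gd gE].
have fd' : differentiable f (g a) by apply/derivable1_diffP.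
have gd' : differentiable g a by apply/derivable1_diffP.
split; first by apply/derivable1_diffP; exact: differentiable_comp.
rewrite deriveE; last exact: differentiable_comp.
have dgE : 'd g a 1 = dg by rewrite -deriveE.
rewrite diff_comp//= dgE -[dg in LHS]mulr1 -[dg * 1]/(dg *: 1 : R) linearZ/=.
by rewrite -deriveE// fE.
Qed.

Lemma is_derive_dot (u v : R -> 'cV[R]_3) (s : R) du dv :
  is_derive s 1 u du -> is_derive s 1 v dv ->
  is_derive s 1 (fun t => dot (u t) (v t)) (dot du (v s) + dot (u s) dv).
Proof.
move=> ud vd.
have h i := is_deriveM (is_derive_coord _ _ _ _ _ i 0 ud) (is_derive_coord _ _ _ _ _ i 0 vd).
have := is_derive_sum h; rewrite (_ : \sum_i _ = (fun t => dot (u t) (v t))); last first.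
  by apply/funext => t; rewrite fct_sumE.
move=> /is_derive_eq; apply.
rewrite /dot -big_split/=.
by apply: eq_bigr => i _; rewrite /GRing.scale/=; ring.
Qed.

Lemma is_derive_mulmx (A : 'M[R]_3) (u : R -> 'cV[R]_3) (s : R) du :
  is_derive s 1 u du -> is_derive s 1 (fun t => A *m u t) (A *m du).
Proof.
move=> ud; apply: is_derive_mx => i j.
have h l := is_deriveZ (A i l) (is_derive_coord _ _ _ _ _ l j ud).
have := is_derive_sum h; rewrite (_ : \sum_l _ = (fun t => (A *m u t) i j)); last first.
  by apply/funext => t; rewrite fct_sumE mxE.
by move=> /is_derive_eq; apply; rewrite mxE.
Qed.

Lemma is_derive_cross (u v : R -> 'cV[R]_3) (s : R) du dv :
  is_derive s 1 u du -> is_derive s 1 v dv ->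
  is_derive s 1 (fun t => u t *x v t) (du *x v s + u s *x dv).
Proof.
move=> ud vd; apply: is_derive_mx => i j; rewrite ord1.
have h l l' := is_deriveM (is_derive_coord _ _ _ _ _ l 0 ud) (is_derive_coord _ _ _ _ _ l' 0 vd).
rewrite (_ : (fun t => _) = ((fun t => u t (i + 1) 0) * (fun t => v t (i + 2) 0) -
   (fun t => u t (i + 2) 0) * (fun t => v t (i + 1) 0))); last first.
  by apply/funext => t; rewrite mxE.
apply: (is_derive_eq (is_deriveB (h _ _) (h _ _))).
rewrite !mxE /GRing.scale/=; ring.
Qed.

(** The mean value theorem evaluates [df] at an interior point [c > 0], where the factor [s] can be
    cancelled. *)
Lemma is_derive_const_on (f df : R -> R) :
  (forall s : R, `|s| < 1 -> is_derive s 1 f (df s)) ->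
  (forall s, `|s| < 1 -> s * df s = 0) ->
  forall s, 0 <= s < 1 -> f s = f 0.
Proof.
move=> fd sdf s /andP[]; rewrite le_eqVlt => /orP[/eqP<-//|s0] s1.
have fd' x : x \in `]0, s[%R -> is_derive x 1 f (df x).
  rewrite in_itv/= => /andP[x0 xs]; apply: fd.
  by rewrite gtr0_norm// (lt_trans xs).
have fc : {within `[0, s], continuous f}.
  apply: continuous_in_subspaceT => x; rewrite inE/= in_itv/= => /andP[x0 xs].
  have /fd/is_derive_continuous// : `|x| < 1 by rewrite ger0_norm// (le_lt_trans xs).
have [c] := MVT s0 fd' fc.
rewrite in_itv/= => /andP[c0 cs] /eqP; rewrite subr_eq => /eqP ->.
have /eqP : c * df c = 0 by apply: sdf; rewrite gtr0_norm// (lt_trans cs).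
by rewrite mulf_eq0 gt_eqF//= => /eqP->; rewrite mul0r add0r.
Qed.

End Derivatives.

(** * The orbit leaving the inverted equilibrium *)

Section Pendulum.
Context {R : realType}.
Implicit Types (J : 'M[R]_3) (G rho w : 'cV[R]_3).

(* [w] is the body angular velocity; for zero vertical momentum it is recovered
   from [V = G *x w] as [V *x G - b G], so the reduced field is Euler's equation. *)
Lemma routh_field_lift J m g rho G w : sym_posdef J -> dot G G = 1 ->
  dot G (J *m w) = 0 ->
  routh_field J m g rho 0 (G, G *x w) =
  (G *x w, (G *x w) *x w +
    G *x (invmx J *m ((J *m w) *x w - (m * g) *: (G *x rho)))).
Proof.
move=> Jpd G1 GJw; have [Jsym Jpos] := Jpd.
have G0 : G != 0 by apply/eqP => G0; move: G1; rewrite G0 dot0v => /eqP; rewrite eq_sym oner_eq0.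
have GJG : dot G (J *m G) != 0 by rewrite gt_eqF// Jpos.
have VG : (G *x w) *x G = w - dot G w *: G.
  by rewrite double_crossl G1 scale1r (dotC w).
(* Symmetry of [J] and zero momentum make [w . J G] vanish, which leaves only the [G] component of
   [V *x G]. *)
have bE : pend_b J G (G *x w) = - dot G w.
  rewrite /pend_b VG dotDr dotNr dotZr (dotC _ w) (dotC _ G).
  have -> : dot w (J *m G) = 0 by rewrite dot_mulmxr Jsym dotC.
  by field.
have nu0 : pend_nu J 0 G = 0 by rewrite /pend_nu mul0r.
rewrite /routh_field /pend_Sigma /pend_c /= nu0 bE VG.
rewrite !mul0r !scale0r expr0n/= scale0r subr0 addr0 !scaleNr !opprK.
congr (_, _).
have -> : J *m (w - dot G w *: G) + dot G w *: (J *m G) = J *m w.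
  by rewrite mulmxBr -scalemxAr subrK.
rewrite subrK enorm_sq crossDr addrA; congr (_ + _).
(* What remains is [- |V|^2 G - (G . w) (G *x V) = V *x w] for [V = G *x w], by expanding the double
   products with [|G| = 1]. *)
rewrite double_crossl crossNr crossZr (crossC G (G *x w)) double_crossl G1 scale1r.
have -> : dot (G *x w) (G *x w) = dot w w - dot G w ^+ 2.
  by rewrite dot_cross_rot (crossC w) double_crossl dotNr dotDr dotNr !dotZr G1; ring.
by rewrite (dotC w G); apply/matrixP => i j; rewrite !mxE; ring.
Qed.

End Pendulum.

(** * Instability from an orbit emanating from the equilibrium *)

Section Instability.
Context {R : realType}.

(* In the time [t] with [s = s2 * expR (lam * t)], [X] is an orbit that takes
   [X s2], arbitrarily close to [X 0], to [X s1]. *)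
Lemma unstable_of_orbit (U : normedModType R) (M : set U) (f : U -> U)
    (lam s1 : R) (X dX : R -> U) :
  0 < lam -> 0 < s1 < 1 -> X s1 != X 0 ->
  (forall s : R, `|s| < 1 -> is_derive s 1 X (dX s)) ->
  (forall s, 0 <= s < 1 -> M (X s)) ->
  (forall s, 0 <= s < 1 -> (s * lam) *: dX s = f (X s)) ->
  ~ lyapunov_stable M f (X 0).
Proof.
move=> lam0 /andP[s10 s11] Xs1 Xd XM Xf stab.
(* The tested ball has [X s1] on its boundary, so reaching [X s1] violates the strict inequality. *)
have e0 : 0 < `|X s1 - X 0| by rewrite normr_gt0 subr_eq0.
have [d d0 hd] := stab _ e0.
have Xc : {for 0, continuous X}.
  by apply: is_derive_continuous; apply: Xd; rewrite normr0.
have [s2 [s20 s21 Xs2]] : exists s2, [/\ 0 < s2, s2 < s1 & `|X s2 - X 0| < d].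
  have := Xc; move/cvgrPdist_lt => /(_ d d0)[/= r r0 hr].
  exists (Num.min (r / 2) (s1 / 2)).
  have m0 : 0 < Num.min (r / 2) (s1 / 2) by rewrite lt_min !divr_gt0.
  split => //.
    by rewrite gt_min; apply/orP; right; lra.
  rewrite distrC; apply: hr => /=; rewrite sub0r normrN gtr0_norm//.
  by rewrite gt_min; apply/orP; left; lra.
pose sig t : R := s2 * expR (lam * t).
have sig0 t : 0 < sig t by rewrite mulr_gt0// expR_gt0.
have sigE x : 0 < x -> sig (ln (x / s2) / lam) = x.
  move=> x0; rewrite /sig [lam * _]mulrC divfK ?gt_eqF// mulrC.
  by rewrite lnK ?posrE ?divr_gt0// divfK// gt_eqF.
have sig_lt t t' : (sig t < sig t') = (t < t').
  by rewrite /sig ltr_pM2l// ltr_expR ltr_pM2l.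
(* The solution is stopped when [sig] reaches [s3]: beyond [s1], so that [t1] lies in the time
   interval, and still inside the unit disk. *)
pose s3 := (s1 + 1) / 2.
have [s13 s31] : s1 < s3 /\ s3 < 1 by rewrite !midf_lt.
have s30 : 0 < s3 by apply: lt_trans s13.
pose T := ln (s3 / s2) / lam.
pose t1 := ln (s1 / s2) / lam.
have sigd (t : R) : is_derive t 1 sig (sig t * lam).
  have hl : is_derive t 1 (fun t : R => lam * t) (lam * 1).
    exact: (is_deriveZ lam (is_derive_id t 1)).
  have he : is_derive t 1 (fun t : R => expR (lam * t)) (expR (lam * t) * (lam * 1)).
    exact: is_derive1_comp.
  have := is_deriveZ s2 he; rewrite /GRing.scale/= mulr1 mulrA.
  by [].
have sig1 t : t < T -> sig t < 1.
  by rewrite -sig_lt /T sigE// => /lt_trans; apply.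
have xd (t : R) : t < T -> is_derive t 1 (X \o sig) ((sig t * lam) *: dX (sig t)).
  move=> tT; apply: is_derive_comp_real => //.
  by apply: Xd; rewrite gtr0_norm// sig1.
have sol : is_solution M f T (X \o sig).
  split.
  - apply: continuous_in_subspaceT => t; rewrite inE/= in_itv/= => /andP[_ tT].
    exact: is_derive_continuous (xd t tT).
  - by move=> t /andP[_ tT]; apply: XM; rewrite ltW//= sig1.
  - move=> t /andP[_ tT]; rewrite -Xf; first exact: xd.
    by rewrite ltW//= sig1.
have sig00 : sig 0 = s2 by rewrite /sig mulr0 expR0 mulr1.
have t1T : 0 <= t1 < T.
  by apply/andP; split; [apply: ltW|]; rewrite -sig_lt ?sig00 !sigE.
have := hd T _ sol; rewrite /= sig00 => /(_ Xs2 t1 t1T).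
by rewrite sigE// ltxx.
Qed.

(** Otherwise the difference quotients from the right vanish near 0, and with them the
    derivative. *)
Lemma right_nonconstant (G : R -> 'cV[R]_3) (dG : 'cV[R]_3) :
  is_derive (0 : R) 1 G dG -> dG != 0 -> exists2 s1, 0 < s1 < 1 & G s1 != G 0.
Proof.
move=> Gd dG0; apply: contrapT => h.
have {}h (s : R) : 0 < s -> s < 1 -> G s = G 0.
  move=> s0 s1; apply: contrapT => /eqP Gs; apply: h; exists s => //.
  by rewrite s0.
move/eqP: dG0; apply.
have /cvg_dnbhs_at_right/cvg_lim <- // := is_derive_cvg _ _ _ _ Gd.
apply/cvg_lim => //.
apply: (@cvg_trans _ (cst (0 : 'cV[R]_3) @ (0 : R)^'+)); last exact: cvg_cst.
apply: near_eq_cvg; near=> x.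
rewrite /= addr0 h ?subrr ?scaler0 ?[x *: 1]mulr1//.
Unshelve. all: by end_near. Qed.

(** The curve [Y = G - r] with velocity [Y *x W] lies in [TS2] and solves the reduced equation
    because [|Y|^2] and [Y . J W] keep their values 1 and 0 from [s = 0]. *)
Lemma unstable_orbit (J : 'M[R]_3) (m g : R) (rho : 'cV[R]_3) :
  sym_posdef J -> 0 < m -> 0 < g -> rho != 0 ->
  exists (lam : R) (X dX : R -> 'cV[R]_3 * 'cV[R]_3),
  [/\ 0 < lam, X 0 = inverted_equilibrium rho /\
        (exists2 s1, 0 < s1 < 1 & X s1 != X 0),
      forall s : R, `|s| < 1 -> is_derive s 1 X (dX s),
      forall s, 0 <= s < 1 -> TS2 (X s) &
      forall s, 0 <= s < 1 -> (s * lam) *: dX s = routh_field J m g rho 0 (X s)].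
Proof.
move=> Jpd m0 g0 rho0; have [Jsym Jpos] := Jpd.
have l0 : 0 < enorm rho.
  by rewrite sqrtr_gt0 lt_neqAle dot_ge0 eq_sym dot_eq0 rho0.
pose r := (enorm rho)^-1 *: rho.
have rhoE : rho = enorm rho *: r by rewrite scalerA mulfV ?gt_eqF// scale1r.
have r0 : r != 0 by rewrite scaler_eq0 negb_or rho0 invr_neq0// gt_eqF.
have r1 : dot r r = 1.
  by rewrite dotZl dotZr -enorm_sq expr2 mulKf ?mulVf// gt_eqF.
have k0 : 0 < m * g * enorm rho by rewrite !mulr_gt0.
have [lam [G [W [dG [dW [lam0 [G0 W0] dG0 GWd GWeq]]]]]] :=
  unstable_manifold _ _ _ Jpd r0 k0.
pose Y s := G s - r.
have Yd (s : R) : `|s| < 1 -> is_derive s 1 Y (dG s).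
  move=> s1; have [Gd _] := GWd s s1.
  by have := is_deriveB Gd (is_derive_cst r s 1); rewrite subr0.
have in1 (s : R) : 0 <= s < 1 -> `|s| < 1 by move=> /andP[s0 s1]; rewrite ger0_norm.
have lamI (s x : R) : (s * lam) * x = 0 -> s * x = 0.
  by move=> /eqP; rewrite mulrAC mulf_eq0 (gt_eqF lam0) orbF => /eqP.
have Y0 : Y 0 = - r by rewrite /Y G0 sub0r.
have Ynorm (s : R) : 0 <= s < 1 -> dot (Y s) (Y s) = 1.
  move=> s01.
  rewrite (is_derive_const_on _ _ (fun (s : R) s1 =>
    is_derive_dot _ _ _ _ _ (Yd s s1) (Yd s s1)))//.
    by rewrite Y0 dotNl dotNr opprK.
  move=> {}s {}s01; apply: lamI; rewrite (dotC (dG s)) mulrDr -dotZr.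
  have [-> _] := GWeq s s01.
  by rewrite -dot_cross_rot crossvv dot0v addr0.
(* In the derivative, [Y . (J W *x W)] cancels [(Y *x W) . J W], and the torque along [r *x G] is
   orthogonal to [G] and [r], hence to [Y]. *)
have Ymom (s : R) : 0 <= s < 1 -> dot (Y s) (J *m W s) = 0.
  move=> s01.
  rewrite (is_derive_const_on _ _ (fun (s : R) s1 => is_derive_dot _ _ _ _ _ (Yd s s1)
    (is_derive_mulmx J _ _ _ (GWd s s1).2)))//.
    by rewrite W0 mulmx0 dotv0.
  move=> {}s {}s01; apply: lamI; rewrite mulrDr -(dotZl _ (dG s)) -(dotZr _ (Y s)).
  have [-> ->] := GWeq s s01; rewrite -/(Y s).
  rewrite dot_cross_rot -dotDr addrA (crossC (W s)) addNr add0r dotZr.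
  rewrite /Y dotDl dotNl -!dot_cross_rot crossvv dot0v subr0.
  by rewrite dotC -dot_cross_rot crossvv dot0v mulr0.
exists lam, (fun s => (Y s, Y s *x W s)),
  (fun s => (dG s, dG s *x W s + Y s *x dW s)); split=> //.
- split; first by rewrite Y0 W0 crossv0.
  have Gd : is_derive (0 : R) 1 G (dG 0) by apply (GWd 0); rewrite normr0.
  have [s1 s101 Gs1] := right_nonconstant _ _ Gd dG0; exists s1 => //.
  by apply: contra_neq Gs1 => -[/addIr].
- move=> s s1; apply: is_derive_pair; first exact: Yd.
  by apply: is_derive_cross; [exact: Yd|exact: (GWd s s1).2].
- move=> s s01; split; first by apply/enorm_eq1; exact: Ynorm.
  by rewrite /= -dot_cross_rot crossvv dot0v.
- move=> s s01; rewrite routh_field_lift ?Ynorm ?Ymom//.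
  have [eqG eqW] := GWeq s (in1 s s01).
  (* Since [r *x r = 0], the torque [k (r *x G)] is the gravity torque [- m g (Y *x rho)]. *)
  have eqdW : (s * lam) *: dW s =
      invmx J *m ((J *m W s) *x W s - (m * g) *: (Y s *x rho)).
    rewrite -[LHS]mul1mx -(mulVmx (sym_posdef_unit _ Jpd)) -mulmxA -scalemxAr eqW.
    rewrite [in RHS]rhoE crossZr scalerA (crossC (Y s)) scalerN opprK.
    by rewrite /Y crossDr crossNr crossvv subr0.
  apply: injective_projections; first exact: eqG.
  by rewrite -eqdW crossZr -/(Y s) -eqG crossZl -scalerDr.
Qed.

End Instability.

Theorem proposition24 (R : realType) (J : 'M[R]_3) (m g mu : R)
    (rho : 'cV[R]_3)
    (hJ : sym_posdef J) (hm : 0 < m) (hg : 0 < g) (hrho : rho != 0)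
    (hmu : mu = 0) :
  is_equilibrium TS2 (routh_field J m g rho mu) (inverted_equilibrium rho) /\
  ~ lyapunov_stable TS2 (routh_field J m g rho mu) (inverted_equilibrium rho).
Proof.
rewrite hmu.
have [lam [X [dX [lam0 [X0 [s1 s101 Xs1]] Xd XM Xf]]]] :=
  unstable_orbit J m g rho hJ hm hg hrho.
rewrite -X0; split; last exact: unstable_of_orbit lam0 s101 Xs1 Xd XM Xf.
have z01 : ((0 : R) <= 0) && ((0 : R) < 1) by rewrite lexx ltr01.
(* At [s = 0] the left-hand side of the orbit equation vanishes, so the field is zero at [X 0]. *)
by split; [exact: XM|rewrite -Xf// mul0r scale0r].
Qed.
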